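(* $K(n,r) = \infty$ for all integers $n \ge 5$ and all integers $r$ with $\left\lceil \dfrac{n+5}{2} \right\rceil \le r \le n$.
   Context: For a finite metric space $(X,d)$, $\mathcal{M}(X)$ is the space of finite signed (Borel) measures on $X$; $\mathcal{M}_0(X)$ and $\mathcal{M}_1(X)$ are the subsets of measures of total mass $0$ and $1$, respectively. For $\mu \in \mathcal{M}(X)$ put $I(\mu) = \int_X\int_X d(x,y)\,d\mu(x)\,d\mu(y)$, and let $M(X) = \sup\{I(\mu) : \mu \in \mathcal{M}_1(X)\}$ (possibly $\infty$). $X$ is quasihypermetric if $I(\mu) \le 0$ for all $\mu \in \mathcal{M}_0(X)$, and strictly quasihypermetric if in addition, for $\mu \in \mathcal{M}_0(X)$, $I(\mu) = 0$ only when $\mu = 0$. A non-empty subspace $Y$ of a finite quasihypermetric space $X$ (with the restricted metric) is a maximal strictly quasihypermetric subspace of $X$ if $Y$ is strictly quasihypermetric and no strictly quasihypermetric subspace of $X$ properly contains $Y$; all such subspaces of a given finite quasihypermetric $X$ have the same cardinality. For positive integers $n,r$, a finite metric space $(X,d)$ is of type $(n,r)$ if $|X| = n$, $X$ has metric diameter $1$, $X$ is quasihypermetric, $M(X) < \infty$, and the maximal strictly quasihypermetric subspaces of $X$ have cardinality $r$. For pairs $(n,r)$ for which spaces of type $(n,r)$ exist, $K(n,r) = \sup\{M(X) : X \text{ has type } (n,r)\} \in \mathbb{R}\cup\{\infty\}$; such spaces exist for the pairs in question. *)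

(* Defs.v *)
From HB Require Import structures.
From mathcomp Require Import all_boot all_order all_algebra.
From mathcomp Require Import all_classical all_reals all_analysis.

Set Implicit Arguments.
Unset Strict Implicit.
Unset Printing Implicit Defensive.

Import Order.TTheory GRing.Theory Num.Theory.

Local Open Scope classical_set_scope.
Local Open Scope ring_scope.

#[short(type="finMetricType")]
HB.structure Definition FinMetric (K : numDomainType) :=
  { T of Finite T & Metric K T }.

(* Every subset of a finite metric space is Borel, so a finite signed measure
   is determined by the masses of the points: [mu x] stands for mu({x}), and
   integration against [mu] is the sum weighted by these masses. The notions
   below are stated for a distance function on a finite type, so that they
   apply both to a space and to its subspaces. *)
Section energy.
Context {R : realType} {X : finType}.
Implicit Types (d : X -> X -> R) (mu : {ffun X -> R}).

Definition total_mass mu : R := \sum_x mu x.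

Definition energy d mu : R := \sum_y (\sum_x d x y * mu x) * mu y.

Definition max_energy d : \bar R :=
  ereal_sup [set (energy d mu)%:E | mu in [set mu | total_mass mu = 1]].

Definition quasihypermetric d : Prop :=
  forall mu, total_mass mu = 0 -> energy d mu <= 0.

Definition strictly_quasihypermetric d : Prop :=
  quasihypermetric d /\
  forall mu, total_mass mu = 0 -> energy d mu = 0 -> mu = [ffun=> 0].

Definition diameter d : R := sup (range (fun p : X * X => d p.1 p.2)).

End energy.

Definition subspace_dist (R : realType) (X : finMetricType R) (Y : {set X})
    (x y : {z : X | z \in Y}) : R :=
  mdist (val x) (val y).

Definition maximal_strictly_quasihypermetric (R : realType)
    (X : finMetricType R) (Y : {set X}) : Prop :=
  [/\ Y != finset.set0,
      strictly_quasihypermetric (@subspace_dist R X Y) &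
      forall Z : {set X}, Y \proper Z ->
        ~ strictly_quasihypermetric (@subspace_dist R X Z)].

Definition has_type (R : realType) (X : finMetricType R) (n r : nat) : Prop :=
  [/\ #|X| = n,
      diameter (@mdist R X) = 1,
      quasihypermetric (@mdist R X),
      (max_energy (@mdist R X) < +oo)%E &
      forall Y : {set X}, maximal_strictly_quasihypermetric Y -> #|Y| = r].

(* [ereal_sup set0 = -oo], so [K R n r = +oo] entails that spaces of type
   (n, r) exist. *)
Definition K (R : realType) (n r : nat) : \bar R :=
  ereal_sup [set m | exists X : finMetricType R,
                       has_type X n r /\ m = max_energy (@mdist R X)].

(* Main.v *)
Require Import Defs.
From HB Require Import structures.
From mathcomp Require Import all_boot all_order all_algebra.
From mathcomp Require Import all_classical all_reals all_analysis.
From mathcomp Require Import ring lra zify.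

(** If [X] and [Y] are joined by a constant cross distance [c], then the energy
    of a measure of mass 0 with mass [a] on [X] is at most
    [(M(X) + M(Y) - 2c) a^2], and
    [M = (c^2 - M(X) M(Y)) / (2c - M(X) - M(Y))].
    When [M(X) <> M(Y)] this blows up as [2c] decreases to [M(X) + M(Y)].

    Take for [X] the cocktail party space, made of [m] antipodal pairs at
    distance 1 with all other distances equal to 1/2, so that [M(X) = 1/2], and
    for [Y] the equilateral space on [s >= 3] points, with [M(Y) = 1 - 1/s].
    A measure of mass 0 has energy 0 exactly when it vanishes on [Y] and is
    constant on each pair of [X]. A subspace is therefore strictly
    quasihypermetric iff it contains at most one full pair, and the maximal
    ones have [m + s + 1] of the [2m + s] points. *)

Set Implicit Arguments.
Unset Strict Implicit.
Unset Printing Implicit Defensive.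

Import Order.TTheory GRing.Theory Num.Theory.

Local Open Scope ring_scope.

(** * Measures on a subspace, seen as measures on the whole space *)

Section subspace.
Context {R : realType} {X : finMetricType R}.
Implicit Types (Y : {set X}) (mu : {ffun X -> R}).

Definition extend_by_zero Y (nu : {ffun {z : X | z \in Y} -> R}) :
  {ffun X -> R} := [ffun x => if insub x is Some y then nu y else 0].

Lemma extend_by_zero_val Y (nu : {ffun {z : X | z \in Y} -> R}) y :
  extend_by_zero nu (val y) = nu y.
Proof. by rewrite ffunE valK. Qed.

Lemma extend_by_zero_out Y (nu : {ffun {z : X | z \in Y} -> R}) x :
  x \notin Y -> extend_by_zero nu x = 0.
Proof. by move=> xY; rewrite ffunE insubN. Qed.

Lemma sum_sub Y (F : X -> R) : (forall x, x \notin Y -> F x = 0) ->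
  \sum_x F x = \sum_(y : {z : X | z \in Y}) F (val y).
Proof.
move=> F0; rewrite -(big_sub (mem Y)) /= [RHS]big_mkcond /=.
by apply: eq_bigr => x _; case: ifPn => // /F0.
Qed.

Lemma total_mass_extend Y (nu : {ffun {z : X | z \in Y} -> R}) :
  total_mass (extend_by_zero nu) = total_mass nu.
Proof.
rewrite /total_mass (@sum_sub Y); last exact: extend_by_zero_out.
by apply: eq_bigr => y _; rewrite extend_by_zero_val.
Qed.

Lemma energy_extend Y (nu : {ffun {z : X | z \in Y} -> R}) :
  energy mdist (extend_by_zero nu) = energy (@subspace_dist R X Y) nu.
Proof.
rewrite /energy (@sum_sub Y) => [|y yY]; last first.
  by rewrite extend_by_zero_out ?mulr0.
apply: eq_bigr => y _; rewrite extend_by_zero_val (@sum_sub Y) => [|x xY].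
  by congr (_ * _); apply: eq_bigr => x _; rewrite extend_by_zero_val.
by rewrite extend_by_zero_out ?mulr0.
Qed.

(** Extension by zero preserves mass and energy, so the inequality on [Y] is inherited from the
    whole space and only the equality case remains. *)
Lemma strictly_quasihypermetric_subspaceP Y :
  quasihypermetric (@mdist R X) ->
  strictly_quasihypermetric (@subspace_dist R X Y) <->
  forall mu, (forall x, x \notin Y -> mu x = 0) ->
    total_mass mu = 0 -> energy mdist mu = 0 -> mu = [ffun=> 0].
Proof.
move=> qh; split=> [[_ sY] mu mu0 m0 e0|sY].
- pose nu : {ffun {z : X | z \in Y} -> R} := [ffun y => mu (val y)].
  have numu : extend_by_zero nu = mu.
    apply/ffunP => x; rewrite ffunE; case: insubP => [y _ <-|/mu0//].
    by rewrite ffunE.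
  apply/ffunP => x; rewrite -numu.
  have -> : nu = [ffun=> 0].
    by apply: sY; rewrite -?energy_extend -?total_mass_extend ?numu.
  by rewrite !ffunE; case: insub => // y; rewrite ffunE.
- split=> [nu|nu].
    by rewrite -total_mass_extend -energy_extend; exact: qh.
  rewrite -total_mass_extend -energy_extend => m0 e0.
  have nu0 := sY _ (@extend_by_zero_out Y nu) m0 e0.
  by apply/ffunP => y; rewrite -extend_by_zero_val nu0 !ffunE.
Qed.

End subspace.

(** * The metric of the join *)

Definition cocktail_join (m s : nat) : finType := ('I_m * bool + 'I_s)%type.

Section dist.
Context {R : realType} {m s : nat}.
Variable c : R.
Implicit Types x y z : cocktail_join m s.

Definition cj_dist x y : R :=
  match x, y with
  | inl p, inl q => if p == q then 0 else if p.1 == q.1 then 1 else 2^-1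
  | inr i, inr j => (i != j)%:R
  | _, _ => c
  end.

Lemma cj_distxx x : cj_dist x x = 0.
Proof. by case: x => x /=; rewrite eqxx. Qed.

Lemma cj_dist_sym x y : cj_dist x y = cj_dist y x.
Proof. by case: x y => x [] y //=; rewrite eq_sym // [y.1 == _]eq_sym. Qed.

Hypotheses (c_ge : 2^-1 <= c) (c_le : c <= 1).

Lemma cj_dist_ge x y : x != y -> 2^-1 <= cj_dist x y.
Proof.
case: x y => x [] y //= xy.
  have /negPf-> : x != y by apply: contraNN xy => /eqP->.
  by case: eqP => _ //; lra.
have -> : x != y by apply: contraNN xy => /eqP->.
by rewrite mulr1n; lra.
Qed.

Lemma cj_dist_le x y : cj_dist x y <= 1.
Proof.
case: x y => x [] y //=; last by case: eqP => _ /=; lra.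
by case: eqP => _ //; case: eqP => _ //; lra.
Qed.

Lemma cj_dist_positivity x y : cj_dist x y = 0 -> x = y.
Proof. by move=> d0; apply/eqP; apply: contraT => /cj_dist_ge; lra. Qed.

(** Distinct points are at distance between 1/2 and 1, so two nonzero distances already add up to at
    least 1. *)
Lemma cj_dist_triangle y x z : cj_dist x z <= cj_dist x y + cj_dist y z.
Proof.
have [->|xy] := eqVneq x y; first by rewrite cj_distxx add0r.
have [->|yz] := eqVneq y z; first by rewrite cj_distxx addr0.
have := cj_dist_ge xy; have := cj_dist_ge yz; have := cj_dist_le x z; lra.
Qed.

(* The bounds on [c] are arguments of the type so that the metric instance can
   be inferred from it. *)
Definition cj_space : Type :=
  let _ := c_ge in let _ := c_le in cocktail_join m s.

HB.instance Definition _ := Finite.on cj_space.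
HB.instance Definition _ := @isMetric.Build R cj_space cj_dist cj_distxx
  cj_dist_positivity cj_dist_sym cj_dist_triangle.

Definition cj_finMetric : finMetricType R := cj_space.

End dist.

(* Chosen so that [2 * cross_dist s e - M(left) - M(right) = e], where
   M(left) = 1/2 and M(right) = 1 - 1/s. *)
Definition cross_dist (R : realType) (s : nat) (e : R) : R :=
  3 / 4 - s%:R^-1 / 2 + e / 2.

(** * The energy as a quadratic form in diagonal shape *)

Section energy.
Context {R : realType} {m s : nat}.
Implicit Types mu : {ffun cocktail_join m s -> R}.

Lemma sum_cocktail_join (F : cocktail_join m s -> R) :
  \sum_x F x = \sum_i (F (inl (i, true)) + F (inl (i, false)))
               + \sum_j F (inr j).
Proof.
rewrite big_sumType /=; congr (_ + _).
transitivity (\sum_(i : 'I_m) \sum_(b : bool) F (inl (i, b))).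
  by rewrite pair_bigA /=; apply: eq_bigr => -[].
by apply: eq_bigr => i _; rewrite big_bool.
Qed.

Definition left_mass mu : R :=
  \sum_i (mu (inl (i, true)) + mu (inl (i, false))).

Definition right_mass mu : R := \sum_j mu (inr j).

Definition antipodal_gap mu : R :=
  \sum_i (mu (inl (i, true)) - mu (inl (i, false))) ^+ 2.

Definition right_deviation mu : R :=
  \sum_j (mu (inr j) - right_mass mu / s%:R) ^+ 2.

Lemma total_mass_cj mu : total_mass mu = left_mass mu + right_mass mu.
Proof. exact: sum_cocktail_join. Qed.

Lemma sum_pred1 (I : finType) (F : I -> R) j :
  F j = \sum_i (if i == j then F i else 0).
Proof. by rewrite -big_mkcond big_pred1_eq. Qed.

(** Within the left part the distance is the constant 1/2, raised by 1/2 at the antipode and lowered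
    by 1/2 at the point itself. *)
Lemma cj_potential_left (c : R) mu j b :
  \sum_x cj_dist c x (inl (j, b)) * mu x =
  left_mass mu / 2 + (mu (inl (j, ~~ b)) - mu (inl (j, b))) / 2
  + c * right_mass mu.
Proof.
rewrite sum_cocktail_join /= -mulr_sumr; congr (_ + _).
rewrite [left_mass mu / 2]mulr_suml.
rewrite [X in _ = _ + X](sum_pred1 (fun i =>
  (mu (inl (i, ~~ b)) - mu (inl (i, b))) / 2)).
rewrite -big_split /=; apply: eq_bigr => i _.
rewrite -![(_, _) == (j, b)]/((_ == j) && (_ == b)).
by case: eqP => _; case: b => /=; field.
Qed.

Lemma cj_potential_right (c : R) mu j :
  \sum_x cj_dist c x (inr j) * mu x =
  c * left_mass mu + right_mass mu - mu (inr j).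
Proof.
rewrite sum_cocktail_join /= -addrA; congr (_ + _).
  by rewrite mulr_sumr; apply: eq_bigr => i _; rewrite mulrDr.
rewrite [X in _ = _ - X](sum_pred1 (fun i => mu (inr i))).
rewrite -sumrB; apply: eq_bigr => i _.
by case: eqP => _ /=; ring.
Qed.

Lemma right_deviationE mu : (0 < s)%N ->
  \sum_j mu (inr j) ^+ 2 = right_deviation mu + right_mass mu ^+ 2 / s%:R.
Proof.
move=> s0; have sN0 : s%:R != 0 :> R by rewrite pnatr_eq0 -lt0n.
have -> : right_deviation mu = \sum_j mu (inr j) ^+ 2
    - 2 * (right_mass mu / s%:R) * \sum_j mu (inr j)
    + \sum_(j < s) (right_mass mu / s%:R) ^+ 2.
  rewrite mulr_sumr -sumrB -big_split /=; apply: eq_bigr => j _; ring.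
rewrite -/(right_mass mu) sumr_const card_ord -mulr_natl; field.
exact: sN0.
Qed.

(** With left mass [a] and right mass [b], the energy is [a^2/2 + 2cab + (1 - 1/s) b^2] minus the
    two square terms. Substituting [a = total_mass mu - b], the choice of [cross_dist] makes the
    coefficient of [b^2] equal to [-e]. *)
Lemma energy_cj (e : R) mu : (0 < s)%N ->
  energy (cj_dist (cross_dist s e)) mu =
  total_mass mu ^+ 2 / 2
  + (2^-1 - s%:R^-1 + e) * total_mass mu * right_mass mu
  - e * right_mass mu ^+ 2 - antipodal_gap mu / 2 - right_deviation mu.
Proof.
move=> s0; have sN0 : s%:R != 0 :> R by rewrite pnatr_eq0 -lt0n.
set c := cross_dist s e.
have -> : energy (cj_dist c) mu =
    (left_mass mu / 2 + c * right_mass mu) * left_mass mu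
    - antipodal_gap mu / 2
    + ((c * left_mass mu + right_mass mu) * right_mass mu
    - \sum_j mu (inr j) ^+ 2).
  rewrite /energy sum_cocktail_join; congr (_ + _).
    rewrite [X in _ = _ * X - _]/left_mass mulr_sumr.
    rewrite [antipodal_gap mu / 2]mulr_suml -sumrB.
    by apply: eq_bigr => i _; rewrite !cj_potential_left /=; field.
  rewrite [X in _ = _ * X - _]/right_mass mulr_sumr -sumrB.
  by apply: eq_bigr => j _; rewrite cj_potential_right; ring.
rewrite right_deviationE// total_mass_cj /c /cross_dist; field.
exact: sN0.
Qed.

End energy.

(** * Counting points of sets with at most one full pair *)

Section full_pairs.
Context {m s : nat}.
Implicit Types Y Z : {set cocktail_join m s}.

Definition full_pair Y (i : 'I_m) : bool :=
  (inl (i, true) \in Y) && (inl (i, false) \in Y).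

Definition at_most_one_full_pair Y : Prop :=
  forall i j, full_pair Y i -> full_pair Y j -> i = j.

Lemma full_pairP Y i b : full_pair Y i -> inl (i, b) \in Y.
Proof. by case: b => /andP[]. Qed.

Lemma full_pairU1 Y x i : full_pair (x |: Y) i ->
  full_pair Y i \/ exists b, x = inl (i, b) /\ inl (i, ~~ b) \in Y.
Proof.
rewrite /full_pair !inE.
have [<-|/=] := eqVneq (inl (i, true)) x.
  by rewrite -[_ == _]/((i == i) && false) andbF /= => ?; right; exists true.
have [<-|/=] := eqVneq (inl (i, false)) x; last by left.
by rewrite andbT => _ ?; right; exists false.
Qed.

(** A maximal [Y] misses exactly one point of each pair except one, hence [m - 1] of the [2m + s]
    points. *)
Lemma card_maximal_full_pair Y : (0 < m)%N -> at_most_one_full_pair Y ->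
  (forall Z, Y \proper Z -> ~ at_most_one_full_pair Z) ->
  #|Y| = (m + s).+1.
Proof.
move=> m_gt0 oneY maxY.
(* Adding a missing point must create a second full pair, so it completes its own pair while some
   pair [q] is full already. *)
have missing x : x \notin Y -> exists k b q,
    [/\ x = inl (k, b), inl (k, ~~ b) \in Y & full_pair Y q].
  move=> xY; apply: contrapT => noq.
  apply: (maxY (x |: Y)).
    rewrite fintype.properE finset.subsetUr /=.
    apply/negP => /fintype.subsetP/(_ x).
    by rewrite !inE eqxx /= (negPf xY) => /(_ isT).
  move=> i j /full_pairU1[Yi|[b [xi Yi]]] /full_pairU1[Yj|[b' [xj Yj]]].
  - exact: oneY.
  - by case: noq; exists j, b', i.
  - by case: noq; exists i, b, j.
  - by move: xi; rewrite xj => -[].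
have [q Yq] : exists q, full_pair Y q.
  have [YT|] := eqVneq (~: Y) finset.set0.
    exists (Ordinal m_gt0); rewrite /full_pair -[Y]finset.setCK YT.
    by rewrite !inE.
  by case/finset.set0Pn => x; rewrite inE => /missing[k [b [q []]]]; exists q.
(* [f] maps the missing points bijectively to the pairs other than [q]. Its value on the right part
   is a dummy, since missing points lie on the left. *)
pose f (x : cocktail_join m s) := if x is inl p then p.1 else q.
have fI : {in ~: Y &, injective f}.
  move=> x y; rewrite !inE => /missing[k [b [_ [-> Yk _]]]] yY.
  have [l [b' [_ [yE _ _]]]] := missing _ yY.
  move: yY; rewrite yE /= => yY kl; rewrite -kl in yY *.
  by congr (inl (_, _)); case: b b' {yE} Yk yY => [] [] //= ->.
have fim : [set f x | x in ~: Y] = [set~ q]%SET.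
  apply/finset.setP => k; rewrite !inE; apply/imsetP/idP => [[x]|kq].
    rewrite inE => xY ->; have [l [b [_ [xE _ _]]]] := missing _ xY.
    rewrite xE /=; apply: contraNN xY => /eqP lq.
    by rewrite xE lq; exact: full_pairP.
  have : ~~ full_pair Y k by apply: contraNN kq => Yk; rewrite (oneY _ _ Yk Yq).
  by rewrite negb_and => /orP[] kY; eexists; rewrite ?inE; try exact: kY.
have := finset.cardsC Y; have := card_in_imset fI; rewrite fim finset.cardsC1.
rewrite card_sum card_prod card_bool !card_ord => <-.
by move: m_gt0; lia.
Qed.

End full_pairs.

Lemma inv_natr_bounds (R : realType) (s : nat) : (2 < s)%N ->
  0 < s%:R^-1 :> R /\ s%:R^-1 <= 3^-1 :> R.
Proof.
by move=> s2; rewrite invr_gt0 ltr0n lef_pV2 ?posrE ?ltr0n ?ler_nat; lia.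
Qed.

(** * Type and maximal energy of the join *)

Section cj_example.
Context {R : realType} {m s : nat}.
Variable e : R.
Hypotheses (m_gt0 : (0 < m)%N) (s_gt2 : (2 < s)%N).
Hypotheses (e_gt0 : 0 < e) (e_le : e <= 2^-1).

Let s_gt0 : (0 < s)%N. Proof. exact: ltn_trans s_gt2. Qed.

Lemma cross_dist_ge : 2^-1 <= cross_dist s e :> R.
Proof.
have [? ?] := inv_natr_bounds R s_gt2; have ? := e_gt0; have ? := e_le.
by rewrite /cross_dist; lra.
Qed.

Lemma cross_dist_le : cross_dist s e <= 1 :> R.
Proof.
have [? ?] := inv_natr_bounds R s_gt2; have ? := e_gt0; have ? := e_le.
by rewrite /cross_dist; lra.
Qed.

Definition cj_example : finMetricType R :=
  @cj_finMetric R m s _ cross_dist_ge cross_dist_le.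

Implicit Types mu : {ffun cj_example -> R}.

Lemma energy_cj_example mu :
  energy mdist mu = total_mass mu ^+ 2 / 2
  + (2^-1 - s%:R^-1 + e) * total_mass mu * right_mass mu
  - e * right_mass mu ^+ 2 - antipodal_gap mu / 2 - right_deviation mu.
Proof. exact: energy_cj. Qed.

Lemma antipodal_gap_ge0 mu : 0 <= antipodal_gap mu.
Proof. by apply: sumr_ge0 => i _; exact: sqr_ge0. Qed.

Lemma right_deviation_ge0 mu : 0 <= right_deviation mu.
Proof. by apply: sumr_ge0 => i _; exact: sqr_ge0. Qed.

(** Minus a sum of nonnegative terms: this gives both the quasihypermetric inequality and its
    equality case. *)
Lemma energy_mass0 mu : total_mass mu = 0 -> energy mdist mu =
  - (e * right_mass mu ^+ 2 + antipodal_gap mu / 2 + right_deviation mu).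
Proof. by move=> m0; rewrite energy_cj_example m0; ring. Qed.

Lemma cj_example_quasihypermetric : quasihypermetric (@mdist R cj_example).
Proof.
move=> mu /energy_mass0->; rewrite oppr_le0.
have := antipodal_gap_ge0 mu; have := right_deviation_ge0 mu.
have : 0 <= e * right_mass mu ^+ 2 by rewrite mulr_ge0 ?sqr_ge0 ?ltW.
by lra.
Qed.

(** At total mass 1 the energy is at most [1/2 + k b - e b^2] in the right mass [b]; the bound is
    the value at the vertex [b = k / (2e)]. *)
Lemma max_energy_cj_example_fin : (max_energy (@mdist R cj_example) < +oo)%E.
Proof.
pose k : R := 2^-1 - s%:R^-1 + e.
apply: (@le_lt_trans _ _ (2^-1 + k ^+ 2 / (4 * e))%:E); last exact: ltry.
apply: ge_ereal_sup => _ [mu /= mu1 <-]; rewrite lee_fin.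
rewrite energy_cj_example mu1 -/k.
have := antipodal_gap_ge0 mu; have := right_deviation_ge0 mu.
have : 0 <= e * (right_mass mu - k / (2 * e)) ^+ 2.
  by rewrite mulr_ge0 ?sqr_ge0 ?ltW.
have -> : e * (right_mass mu - k / (2 * e)) ^+ 2 =
    e * right_mass mu ^+ 2 - k * right_mass mu + k ^+ 2 / (4 * e).
  by field; rewrite gt_eqF.
by lra.
Qed.

Lemma cj_example_diameter : diameter (@mdist R cj_example) = 1.
Proof.
pose p : cj_example * cj_example :=
  (inr (Ordinal s_gt0), inr (Ordinal (ltn_trans (ltnSn 1) s_gt2))).
have ub1 : ubound (range (fun p : cj_example * cj_example => mdist p.1 p.2)) 1.
  by move=> _ [q _ <-]; apply: cj_dist_le; exact: cross_dist_le.
have p1 : mdist p.1 p.2 = 1 by [].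
apply/eqP; rewrite eq_le; apply/andP; split.
  by apply: ge_sup => //; exists 1, p.
by apply: ub_le_sup; [exists 1 | exists p].
Qed.

Lemma strictly_quasihypermetric_cj_example (Y : {set cj_example}) :
  strictly_quasihypermetric (@subspace_dist R cj_example Y) <->
  at_most_one_full_pair Y.
Proof.
rewrite (strictly_quasihypermetric_subspaceP _ cj_example_quasihypermetric).
split=> [sY i j Yi Yj|oneY mu muY m0].
- apply/eqP; apply: contraT => ij.
  (* Mass 1 on both points of pair [i] and -1 on both points of pair [j]: a nonzero measure of mass
     0 and energy 0. *)
  pose mu : {ffun cocktail_join m s -> R} := [ffun x =>
    if x is inl p then (p.1 == i)%:R - (p.1 == j)%:R else 0].
  have B0 : right_mass mu = 0 by apply: big1 => k _; rewrite ffunE.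
  have A0 : left_mass mu = 0.
    rewrite /left_mass; under eq_bigr do rewrite !ffunE /=.
    rewrite big_split /= sumrB.
    have d1 k : \sum_(l < m) (l == k)%:R = 1 :> R.
      by rewrite (bigD1 k)//= eqxx big1 ?addr0 // => l /negPf->.
    by rewrite !d1 subrr addr0.
  have mu0 : total_mass mu = 0 by rewrite total_mass_cj A0 B0 addr0.
  have E0 : @energy R cj_example mdist mu = 0.
    rewrite energy_mass0// B0 /antipodal_gap /right_deviation B0.
    rewrite !big1 => [|k _|k _].
    - by rewrite expr0n /= mulr0 mul0r !addr0 oppr0.
    - by rewrite ffunE mul0r subrr expr0n.
    - by rewrite !ffunE subrr expr0n.
  suff /ffunP/(_ (inl (i, true))) : mu = [ffun=> 0].
    by rewrite !ffunE /= eqxx (negPf ij) subr0 => /eqP; rewrite oner_eq0.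
  apply: sY => // -[[k b]|k]; rewrite ffunE //=.
  have [->|_] := eqVneq k i; first by rewrite full_pairP.
  have [->|_] := eqVneq k j; first by rewrite full_pairP.
  by rewrite subrr.
- rewrite energy_mass0// => /eqP; rewrite oppr_eq0.
  have D_ge0 := antipodal_gap_ge0 mu; have V_ge0 := right_deviation_ge0 mu.
  have eB_ge0 : 0 <= e * right_mass mu ^+ 2 by rewrite mulr_ge0 ?sqr_ge0 ?ltW.
  rewrite !paddr_eq0 ?addr_ge0 ?divr_ge0//.
  move=> /andP[/andP[/eqP B0 /eqP D0] /eqP V0].
  have {}B0 : right_mass mu = 0.
    by move/eqP: B0; rewrite mulf_eq0 gt_eqF//= sqrf_eq0 => /eqP.
  have {D0} : antipodal_gap mu = 0 by lra.
  move/eqP; rewrite psumr_eq0; last by move=> *; exact: sqr_ge0.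
  move=> /allP D0; move/eqP: V0.
  rewrite psumr_eq0; last by move=> *; exact: sqr_ge0.
  move=> /allP V0.
  have eqb i : mu (inl (i, true)) = mu (inl (i, false)).
    have := D0 i; rewrite mem_index_enum => /(_ isT) /=.
    by rewrite sqrf_eq0 subr_eq0 => /eqP.
  have eqb2 i b b' : mu (inl (i, b)) = mu (inl (i, b')).
    by case: b b' => [] [].
  have right0 j : mu (inr j) = 0.
    have := V0 j; rewrite mem_index_enum => /(_ isT) /=.
    by rewrite B0 mul0r subr0 sqrf_eq0 => /eqP.
  (* One point of the pair is outside [Y] and has mass 0, and its antipode has the same mass. *)
  have notfull i b : ~~ full_pair Y i -> mu (inl (i, b)) = 0.
    by rewrite negb_and => /orP[] /muY <-; exact: eqb2.
  apply/ffunP => -[[i b]|j]; rewrite [RHS]ffunE; last exact: right0.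
  have [Yi|/notfull//] := boolP (full_pair Y i).
  (* Only pair [i] can carry mass; its two masses are equal and sum to 0. *)
  move: m0; rewrite total_mass_cj B0 addr0 /left_mass (bigD1 i)//=.
  rewrite big1 => [|k ki].
    by rewrite (eqb2 i true b) (eqb2 i false b); lra.
  have nYk : ~~ full_pair Y k.
    by apply: contraNN ki => Yk; apply/eqP; exact: oneY.
  by rewrite !notfull// addr0.
Qed.

Lemma cj_example_type : has_type cj_example (m.*2 + s) (m + s).+1.
Proof.
split.
- by rewrite card_sum card_prod card_bool !card_ord muln2.
- exact: cj_example_diameter.
- exact: cj_example_quasihypermetric.
- exact: max_energy_cj_example_fin.
- move=> Y [_ /strictly_quasihypermetric_cj_example oneY maxY].
  apply: card_maximal_full_pair => // Z YZ oneZ.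
  by apply: (maxY Z YZ); exact/strictly_quasihypermetric_cj_example.
Qed.

(** The test measure spreads [t] evenly over the right part and [1 - t] evenly over one pair, so
    both square terms vanish. The slope 1/6 comes from [1/2 - 1/s >= 1/6] for [s >= 3]. *)
Lemma max_energy_cj_example_ge (t : R) : 0 <= t ->
  ((t / 6 - e * t ^+ 2)%:E <= max_energy (@mdist R cj_example))%E.
Proof.
move=> t_ge0.
pose mu : {ffun cocktail_join m s -> R} := [ffun x =>
  if x is inl p then (p.1 == Ordinal m_gt0)%:R * ((1 - t) / 2) else t / s%:R].
have sN0 : s%:R != 0 :> R by rewrite pnatr_eq0 -lt0n.
have B : right_mass mu = t.
  rewrite /right_mass; under eq_bigr do rewrite ffunE.
  by rewrite sumr_const card_ord -[LHS]mulr_natr divfK.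
have A : left_mass mu = 1 - t.
  rewrite /left_mass (bigD1 (Ordinal m_gt0))//= big1 => [|k /negPf k0].
    by rewrite !ffunE /= mul1r addr0 -splitr.
  by rewrite !ffunE /= k0 !mul0r addr0.
have mu1 : total_mass mu = 1 by rewrite total_mass_cj A B subrK.
apply: le_trans (ereal_sup_ubound _); last by exists mu => //; exact: mu1.
rewrite lee_fin energy_cj_example mu1 B.
have -> : antipodal_gap mu = 0.
  by apply: big1 => i _; rewrite !ffunE subrr expr0n.
have -> : right_deviation mu = 0.
  by apply: big1 => i _; rewrite ffunE B subrr expr0n.
have [_ invs_le] := inv_natr_bounds R s_gt2.
have : 0 <= (2^-1 - s%:R^-1 + e - 6^-1) * t.
  by rewrite mulr_ge0//; have := e_gt0; lra.
by lra.
Qed.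

End cj_example.

Theorem theorem3p6 (R : realType) (n r : nat) :
  (5 <= n)%N -> (uphalf (n + 5) <= r)%N -> (r <= n)%N ->
  K R n r = (+oo)%E.
Proof.
move=> n_ge5 r_ge r_le.
(* The solution of [2m + s = n] and [m + s + 1 = r]. Here [s = 2r - n - 2], so the lower bound on
   [r] says exactly that [s >= 3]. *)
pose m := (n - r).+1; pose s := (n - m.*2)%N.
have nE : n = (m.*2 + s)%N by rewrite /s /m; lia.
have rE : r = (m + s).+1 by rewrite /s /m; lia.
have s_gt2 : (2 < s)%N by rewrite /s /m; lia.
apply: eq_infty => A.
(* With [e = 1 / (12t)] the lower bound [t/6 - e t^2] becomes [t/12], which is at least [A]. The
   maximum with 1 keeps [t] positive and [e] below 1/2. *)
pose t : R := Num.max 1 (12 * A).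
have t_ge1 : 1 <= t by rewrite le_max lexx.
have t_geA : 12 * A <= t by rewrite le_max lexx orbT.
have t_gt0 : 0 < t by exact: lt_le_trans t_ge1.
pose e : R := (12 * t)^-1.
have e_gt0 : 0 < e by rewrite invr_gt0 mulr_gt0.
have e_le : e <= 2^-1 by rewrite lef_pV2 ?posrE ?mulr_gt0//; lra.
pose X := @cj_example R m s e s_gt2 e_gt0 e_le.
apply: (@le_trans _ _ (max_energy (@mdist R X))).
  apply: le_trans (max_energy_cj_example_ge _ _ _ _ (ltW t_gt0)) => //.
  have -> : t / 6 - e * t ^+ 2 = t / 12 by rewrite /e; field; rewrite gt_eqF.
  by rewrite lee_fin; lra.
apply: ereal_sup_ubound; exists X; split => //.
by rewrite nE rE; exact: cj_example_type.
Qed.
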